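(* Let $A\in \mathcal{C}_2(\mathcal{H})$ and let $0\leq \nu \leq 1$. Then $$w_{(2,\nu)}^2(A) = (2\nu^2-2\nu+1)\|A\|_{2}^2 + 2\nu(1-\nu)\left|\mathrm{tr}(A^2)\right|.$$
   Context: $\mathcal{H}$ is a complex Hilbert space. $\mathcal{C}_2(\mathcal{H})$ is the Hilbert--Schmidt class, i.e. the bounded linear operators $A$ on $\mathcal{H}$ with $\|A\|_2=\sqrt{\mathrm{tr}(A^*A)}<\infty$, where $\mathrm{tr}$ is the usual trace. For $0\leq\nu\leq1$ and $A\in\mathcal{C}_2(\mathcal{H})$, define $$w_{(2,\nu)}(A)=\sup_{\theta\in\mathbb{R}}\left\|\nu e^{i\theta}A+(1-\nu)e^{-i\theta}A^*\right\|_2,$$ and $w_{(2,\nu)}^2(A)$ means $\left(w_{(2,\nu)}(A)\right)^2$. *)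

(* Defs.v *)
From HB Require Import structures.
From mathcomp Require Import all_boot all_order all_algebra finmap complex.
From mathcomp Require Import all_classical all_reals all_analysis.
From mathcomp.analysis.showcase Require summability.

Set Implicit Arguments.
Unset Strict Implicit.
Unset Printing Implicit Defensive.

Import Order.TTheory GRing.Theory Num.Theory.
Import numFieldNormedType.Exports.
Local Open Scope classical_set_scope.
Local Open Scope ring_scope.
Local Open Scope complex_scope.

(* [inner] is linear in its first argument and antilinear in the second. *)
Record hilbertType (R : realType) := HilbertType {
  hilbert_sort :> completeNormedModType R[i];
  inner : {dot hilbert_sort for @Num.conj R[i]};
  inner_norm : forall x : hilbert_sort, `|x| ^+ 2 = inner x x }.

Section Operators.
Context {R : realType} {H : hilbertType R}.
Implicit Types (A T : H -> H) (E : set H).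

Definition orthonormal_set E :=
  forall x y : H, E x -> E y -> inner H x y = (x == y)%:R.

Definition orthonormal_basis E :=
  orthonormal_set E /\
  (forall x : H, (forall e : H, E e -> inner H x e = 0) -> x = 0).

Lemma innerC (x y : H) : inner H y x = (inner H x y)^*.
Proof. by rewrite (hermC (inner H) y x) expr0 mul1r. Qed.

Lemma inner_eq0 (x y : H) : inner H x y = 0 -> inner H y x = 0.
Proof. by move=> xy; rewrite innerC xy conjc0. Qed.

Lemma orthonormal_basis_exists : exists E : set H, orthonormal_basis E.
Proof.
have [F FP Fchain|E [Eon Emax]] := @Zorn_bigcup H orthonormal_set.
  move=> x y [X FX Xx] [Y FY Yy].
  by case: (Fchain _ _ FX FY) => XY; [apply: (FP _ FY) => //; exact: XY |
    apply: (FP _ FX) => //; exact: XY].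
exists E; split=> // x xE; apply: contrapT => /eqP x0.
have nx0 : `|x| != 0 :> R[i] by rewrite normr_eq0.
pose u : H := `|x|^-1 *: x.
have uE e : E e -> inner H u e = 0.
  by move=> Ee; rewrite /u linearZl_LR /= xE// mulr0.
have uu : inner H u u = 1.
  by rewrite -inner_norm /u normrZ normfV normr_id mulVf// expr1n.
have nEu : ~ E u by move=> /uE; rewrite uu => /eqP; rewrite oner_eq0.
have EEu : E `<` E `|` [set u].
  split=> [y Ey|EuE]; first by left.
  by apply: nEu; apply: EuE; right.
apply: (Emax _ EEu) => {EEu}.
move=> y z [Ey|->] [Ez|->]; first exact: Eon.
- rewrite inner_eq0 ?uE//; case: eqP => // yu; by rewrite -yu in nEu.
- rewrite uE//; case: eqP => // yu; by rewrite yu in nEu.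
- by rewrite uu eqxx.
Qed.

(* The sum is unordered: [summability.totally] is the filter of finite subsets
   of the basis directed by inclusion.  The bounded operators with a trace in this
   sense are the trace-class ones; for a positive operator the diagonal sums
   are sums of nonnegative reals, so having a trace means having a finite
   one. *)
Definition has_trace T (z : R[i]) :=
  forall E, orthonormal_basis E ->
    (summability.partial_sum (fun e : E => inner H (T (val e)) (val e))
      @ summability.totally --> (z : R[i]^o)).

Lemma has_trace_unique T (z1 z2 : R[i]) :
  has_trace T z1 -> has_trace T z2 -> z1 = z2.
Proof.
have [E onbE] := orthonormal_basis_exists => /(_ _ onbE) h1 /(_ _ onbE) h2.
apply: (@cvg_unique (R[i]^o) (@norm_hausdorff _ (R[i]^o)) _
  (fmap_proper_filter _ (@summability.totally_filter _)) _ _ h1 h2).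
Qed.

(* By convention 0 on operators that have no trace. *)
Definition trace T : R[i] := xget 0 [set z | has_trace T z].

Lemma traceE T z : has_trace T z -> trace T = z.
Proof.
by move=> Tz; apply: xget_unique => // y Ty; exact: has_trace_unique Ty Tz.
Qed.

(* For bounded linear [T] this is the Hilbert-space adjoint, which exists by
   the Riesz representation theorem and is unique. *)
Definition adjoint T : H -> H :=
  xget (fun=> 0) [set S | forall x y : H, inner H (T x) y = inner H x (S y)].

Lemma adjoint_unique T S : (forall x y, inner H (T x) y = inner H x (S y)) ->
  adjoint T = S.
Proof.
move=> TS; apply: xget_unique => // S' TS'; apply/funext => y.
apply/eqP; rewrite -subr_eq0; apply/eqP; apply: contrapT => /eqP d0.
have := neq0_dnorm_gt0 (s := inner H) _ d0.
by rewrite linearBr /= -TS -TS' subrr ltxx.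
Qed.

(* The second conjunct says that tr(A^* A) is finite. *)
Definition hilbert_schmidt (A : {linear H -> H}) :=
  bounded_near A (nbhs (0 : H)) /\
  exists z, has_trace (adjoint A \o A) z.

Definition hs_norm A : R := Num.sqrt (complex.Re (trace (adjoint A \o A))).

Definition cis (t : R) : R[i] := cos t +i* sin t.

Definition w2 (nu : R) A : R :=
  sup [set hs_norm (fun x : H => (nu%:C * cis t) *: A x
                        + ((1 - nu)%:C * cis (- t)) *: adjoint A x)
      | t in [set: R]].

End Operators.

(* Main.v *)
Require Import Defs.
From HB Require Import structures.
From mathcomp Require Import all_boot all_order all_algebra finmap complex.
From mathcomp Require Import all_classical all_reals all_analysis.
From mathcomp Require Import ring.
From mathcomp.analysis.showcase Require Import summability.

(** Expanding the square gives, for every vector [e],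
      |a A e + b A* e|^2
        = |a|^2 |A e|^2 + |b|^2 |A* e|^2 + 2 Re (a b^* <A e, A* e>),
    and <A e, A* e> = <A (A e), e> is a diagonal entry of [A \o A].  Summing over
    an orthonormal basis with [a = nu e^(it)] and [b = (1 - nu) e^(-it)], and
    using that [A] and [A*] have the same Hilbert-Schmidt norm, the squared norm
    inside the supremum is
      (2 nu^2 - 2 nu + 1) |A|_2^2 + 2 nu (1 - nu) Re (e^(2it) tr (A^2)).
    The phase [t] rotates tr (A^2) freely, so the largest value of the real part
    is |tr (A^2)|, and it is attained ([rotate_to_norm]).

    What takes work is that these sums exist and are the same in every
    orthonormal basis, a trace being here a limit along finite subsets required
    of all bases at once.  Everything rests on one estimate,
    [hs_bound_adjoint]: if [B'] is adjoint to [B], then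
      sum_f |B' f|^2 = sum_f sum_e |<B e, f>|^2 <= sum_e |B e|^2
    by Parseval in one basis and Bessel in the other.  Used in both directions it
    makes the sum for [B] over any basis equal to that of [B'] over any other
    ([hs_sum_adjoint]), hence independent of the basis.  The cross term
    <A e, A* e> is recovered by polarization from the squared norms of
    [A + A*] and [A - i A*] ([cross_sum_exists]), which is how tr (A^2) is seen to
    exist.

    The adjoint of a bounded operator is built from an orthonormal basis
    ([adjoint_exists]), from Bessel, Riesz-Fischer and the basis expansion. *)

Set Implicit Arguments.
Unset Strict Implicit.
Unset Printing Implicit Defensive.

Import Order.TTheory GRing.Theory Num.Theory.
Import numFieldNormedType.Exports.
Local Open Scope classical_set_scope.
Local Open Scope ring_scope.

#[local] Existing Instance totally_filter.

(** * Unordered sums *)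

Section FamilySums.
Context {R : realType} {I : choiceType}.
Local Notation C := (complex R).

Definition has_sum (V : normedModType C) (f : I -> V) (s : V) :=
  partial_sum f @ totally --> s.

Lemma partial_sumE (V : zmodType) (f : I -> V) (A : {fset I}) :
  partial_sum f A = \sum_(i <- A) f i.
Proof. by rewrite /partial_sum big_seq_fsetE. Qed.

Lemma has_sumP (V : normedModType C) (f : I -> V) (s : V) :
  has_sum f s <-> forall e : C, 0 < e -> exists A : {fset I},
    forall B : {fset I}, (A `<=` B)%fset -> `|s - \sum_(i <- B) f i| < e.
Proof.
split=> [/cvgrPdist_lt fs e e0|fs].
  have [A _ AB] := fs e e0.
  by exists A => B AsubB; rewrite -partial_sumE; apply: AB.
apply/cvgrPdist_lt => e e0; have [A AB] := fs e e0.
by exists A => // B /=; rewrite partial_sumE; apply: AB.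
Qed.

Lemma has_sum_unique (V : normedModType C) (f : I -> V) (s t : V) :
  has_sum f s -> has_sum f t -> s = t.
Proof.
apply: (@cvg_unique V (@norm_hausdorff _ V)).
Qed.

Lemma has_sumD (V : normedModType C) (f g : I -> V) (s t : V) :
  has_sum f s -> has_sum g t -> has_sum (fun i => f i + g i) (s + t).
Proof.
move=> fs gt; rewrite /has_sum.
have -> : partial_sum (fun i => f i + g i) = partial_sum f \+ partial_sum g.
  by apply/funext => A /=; rewrite !partial_sumE big_split.
exact: cvgD.
Qed.

Lemma has_sumZ (V : normedModType C) (a : C) (f : I -> V) (s : V) :
  has_sum f s -> has_sum (fun i => a *: f i) (a *: s).
Proof.
move=> fs; rewrite /has_sum.
have -> : partial_sum (fun i => a *: f i) = a \*: partial_sum f.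
  by apply/funext => A /=; rewrite !partial_sumE scaler_sumr.
exact: cvgZr.
Qed.

Lemma has_sum_bigsum (V : normedModType C) (J : Type) (r : seq J)
    (f : J -> I -> V) (s : J -> V) :
  (forall j, has_sum (f j) (s j)) ->
  has_sum (fun i => \sum_(j <- r) f j i) (\sum_(j <- r) s j).
Proof.
move=> fs; elim: r => [|j r IH].
  rewrite big_nil; apply/has_sumP => e e0; exists fset0 => B _.
  by rewrite big1 ?subr0 ?normr0// => i _; rewrite big_nil.
have := has_sumD (fs j) IH; rewrite big_cons; congr has_sum.
by apply/funext => i; rewrite big_cons.
Qed.

Lemma has_sum_conj (f : I -> C^o) (s : C^o) :
  has_sum f s -> has_sum (fun i => (f i)^* : C^o) (s^*).
Proof.
move=> /has_sumP fs; apply/has_sumP => e e0.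
have [A AB] := fs e e0; exists A => B /AB.
by rewrite -rmorph_sum -rmorphB norm_conjC.
Qed.

Lemma sum_fsetD (V : zmodType) (f : I -> V) (A B : {fset I}) :
  (A `<=` B)%fset ->
  \sum_(i <- B) f i = \sum_(i <- A) f i + \sum_(i <- (B `\` A)%fset) f i.
Proof.
move=> AB; rewrite (big_fsetID _ (mem A))/=; congr (_ + _).
  apply: eq_fbigl => x; rewrite !inE/=.
  by case xA: (x \in A); rewrite ?andbF// (fsubsetP AB).
by apply: eq_fbigl => x; rewrite !inE/= andbC.
Qed.

Lemma ler_sum_fsubset (f : I -> C) (A B : {fset I}) : (forall i, 0 <= f i) ->
  (A `<=` B)%fset -> \sum_(i <- A) f i <= \sum_(i <- B) f i.
Proof. by move=> f0 AB; rewrite (sum_fsetD f AB) lerDl sumr_ge0. Qed.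

(** The order on the complex numbers is only partial, so there is no supremum in
    it directly; but the partial sums are real, and their real supremum is both
    the limit and the least complex upper bound. *)
Lemma has_sum_nneg (f : I -> C^o) (M : C) : (forall i, 0 <= (f i : C)) ->
  (forall A : {fset I}, \sum_(i <- A) f i <= M :> C) ->
  exists s : C, [/\ has_sum f s,
    forall A : {fset I}, \sum_(i <- A) f i <= s :> C &
    forall N : C, (forall A : {fset I}, \sum_(i <- A) f i <= N :> C) -> s <= N].
Proof.
move=> f0 fM.
pose g (A : {fset I}) : R := complex.Re (\sum_(i <- A) f i).
have fr (A : {fset I}) : \sum_(i <- A) f i = ((g A)%:C)%C.
  by rewrite /g RRe_real// ger0_real// sumr_ge0.
pose X := range g.
have X0 : X !=set0 by exists (g fset0), fset0.
have leC N (A : {fset I}) : \sum_(i <- A) f i <= N :> C -> g A <= complex.Re N.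
  by rewrite fr lecE /= => /andP[].
have supX : has_sup X.
  split=> //; exists (complex.Re M) => _ [A _ <-]; exact/leC.
have gsup A : g A <= sup X by apply: sup_upper_bound => //; exists A.
exists ((sup X)%:C)%C; split.
- apply/has_sumP => e e0.
  have e0' : 0 < complex.Re e by move: e0; rewrite ltcE/= => /andP[].
  have eE : e = ((complex.Re e)%:C)%C by rewrite RRe_real// gtr0_real.
  have [_ [A _ <-] ltA] := sup_adherent e0' supX.
  exists A => B AB; rewrite fr -rmorphB /= normc_def/= expr0n/= addr0.
  rewrite sqrtr_sqr ger0_norm ?subr_ge0// eE ltcR ltrBlDr -ltrBlDl.
  rewrite (lt_le_trans ltA)//.
  by have := ler_sum_fsubset f0 AB; rewrite !fr lecR.
- by move=> A; rewrite fr lecR.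
- move=> N fN; have := fN fset0; rewrite big_seq_fset0 => /ger0_real N0.
  rewrite -(RRe_real N0) lecR; apply: sup_le_ub => // _ [A _ <-]; exact: leC.
Qed.

(** Convergence alone bounds the partial sums: each is below one that is within 1
    of the limit. *)
Lemma has_sum_ge (f : I -> C^o) (s : C) : (forall i, 0 <= (f i : C)) ->
  has_sum f s -> forall A : {fset I}, \sum_(i <- A) f i <= s :> C.
Proof.
move=> f0 fs.
have [|t [ft tge _]] := @has_sum_nneg f (`|s| + 1) f0.
  move=> A; have /has_sumP /(_ 1 ltr01) [B Bs] := fs.
  apply: (le_trans (ler_sum_fsubset f0 (fsubsetUr B A))).
  have /Bs := fsubsetUl B A; set S := \sum_(i <- _) _ => sS.
  have S0 : 0 <= (S : C) by rewrite sumr_ge0.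
  rewrite -(ger0_norm S0) -[S](subrK s) addrC (le_trans (ler_normD _ _))//.
  by rewrite lerD2l distrC ltW.
by rewrite (has_sum_unique fs ft).
Qed.

Lemma has_sum_le (f : I -> C^o) (s M : C) : (forall i, 0 <= (f i : C)) ->
  has_sum f s -> (forall A : {fset I}, \sum_(i <- A) f i <= M :> C) -> s <= M.
Proof.
move=> f0 fs fM; have [t [ft _ tle]] := has_sum_nneg f0 fM.
by rewrite (has_sum_unique fs ft); exact: tle.
Qed.

End FamilySums.

Arguments has_sumZ {R I V} a {f s}.

(** * Hilbert spaces: orthonormal families, bases and adjoints *)

Section Hilbert.
Context {R : realType} {H : hilbertType R}.
Local Notation C := (complex R).
Local Notation "'[ x , y ]" := (inner H x y : C).
Local Notation "'[ x ]" := (inner H x x : C).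

Lemma inner_conj (x y : H) : '[y, x] = '[x, y]^*.
Proof. exact: innerC. Qed.

Lemma inner_ge0 (x : H) : 0 <= '[x].
Proof. by rewrite -inner_norm exprn_ge0. Qed.

Lemma innerZr (a : C) (x y : H) : '[x, a *: y] = a^* * '[x, y].
Proof. by rewrite linearZr_LR. Qed.

Lemma innerZl (a : C) (x y : H) : '[a *: x, y] = a * '[x, y].
Proof. by rewrite linearZl_LR. Qed.

Lemma inner_suml (J : Type) (r : seq J) (f : J -> H) (y : H) :
  '[\sum_(j <- r) f j, y] = \sum_(j <- r) '[f j, y].
Proof. exact: linear_sumlz. Qed.

Lemma inner_sumr (J : Type) (r : seq J) (f : J -> H) (y : H) :
  '[y, \sum_(j <- r) f j] = \sum_(j <- r) '[y, f j].
Proof. exact: linear_sumr. Qed.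

Section Orthonormal.
Variable E : set H.
Hypothesis Eon : orthonormal_set E.
Implicit Types (A B : {fset E}) (c : E -> C).

Lemma orthonormalE (e f : E) : '[val e, val f] = (e == f)%:R.
Proof. by rewrite Eon ?val_eqE//; exact/set_mem/valP. Qed.

Lemma inner_combination c A (e : E) :
  '[\sum_(i <- A) c i *: val i, val e] = (if e \in A then c e else 0).
Proof.
rewrite inner_suml; under eq_bigr do rewrite innerZl orthonormalE.
case: ifPn => eA.
  rewrite (big_fsetD1 e)//= eqxx mulr1 big_seq big1 ?addr0// => i.
  by rewrite !inE => /andP[/negPf-> _]; rewrite mulr0.
rewrite big_seq big1// => i iA; case: eqP => [ie|]; last by rewrite mulr0.
by rewrite -ie iA in eA.
Qed.

Lemma norm_combination c A :
  '[\sum_(i <- A) c i *: val i] = \sum_(i <- A) `|c i| ^+ 2.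
Proof.
rewrite [LHS]inner_sumr big_seq [RHS]big_seq; apply: eq_bigr => i iA.
by rewrite innerZr inner_combination iA mulrC normCK.
Qed.

(** With [y] the projection of [x] on the span of the finite family, the squared
    norm of [x - y] is [<x, x> - <y, y>]. *)
Lemma bessel (x : H) A : \sum_(e <- A) `|'[x, val e]| ^+ 2 <= '[x].
Proof.
set y := \sum_(e <- A) '[x, val e] *: val e.
have yy : '[y] = \sum_(e <- A) `|'[x, val e]| ^+ 2 by exact: norm_combination.
have xy : '[x, y] = '[y].
  rewrite yy /y inner_sumr; apply: eq_bigr => e _.
  by rewrite innerZr normCK mulrC.
have yx : '[y, x] = '[y] by rewrite inner_conj xy -inner_conj.
have := inner_ge0 (x - y); rewrite linearBl !linearBr /= xy yx subrr subr0.
by rewrite subr_ge0 yy.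
Qed.

End Orthonormal.

Lemma cauchy_schwarz (x y : H) : `|'[x, y]| <= `|x| * `|y|.
Proof.
have [->|y0] := eqVneq y 0; first by rewrite linear0r !normr0 mulr0.
have ny0 : `|y| != 0 :> C by rewrite normr_eq0.
have yy : '[y] = `|y| ^+ 2 by rewrite inner_norm.
pose z := x - ('[x, y] / '[y]) *: y.
have zy : '[z, y] = 0.
  by rewrite /z linearBl/= innerZl divfK ?subrr// yy sqrf_eq0.
have := inner_ge0 z.
have -> : '[z] = '[z, x].
  by rewrite {2}/z linearBr/= innerZr zy mulr0 subr0.
rewrite linearBl/= innerZl [X in _ * X]inner_conj.
rewrite mulrAC -normCK subr_ge0 yy ler_pdivrMr ?exprn_gt0 ?normr_gt0//.
rewrite -inner_norm -exprMn ler_pXn2r//.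
by rewrite nnegrE mulr_ge0.
Qed.

Lemma has_sum_inner (I : choiceType) (f : I -> H) (s : H) :
  has_sum f s -> forall y : H, has_sum (fun i => '[f i, y] : C^o) '[s, y].
Proof.
move=> /has_sumP fs y; apply/has_sumP => e e0.
have d0 : 0 < e / (`|y| + 1) by rewrite divr_gt0// ltr_wpDl.
have [A AB] := fs _ d0; exists A => B /AB.
rewrite -inner_suml -linearBl/= ltr_pdivlMr ?ltr_wpDl//; apply: le_lt_trans.
by rewrite (le_trans (cauchy_schwarz _ _))// ler_wpM2l// lerDl.
Qed.

Arguments has_sum_inner {I f s} _ y.

Section Basis.
Variable E : set H.
Hypothesis Eonb : orthonormal_basis E.
Implicit Types (A B : {fset E}) (c : E -> C).
Let Eon : orthonormal_set E := Eonb.1.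

(** By Pythagoras, the squared distance from a partial sum to a larger one is the
    same difference for the scalar series [|c e|^2], so the vector series is
    Cauchy as soon as the scalar one converges. *)
Lemma riesz_fischer c (M : C) :
  (forall A, \sum_(e <- A) `|c e| ^+ 2 <= M) ->
  exists y : H, has_sum (fun e : E => c e *: (val e : H)) y.
Proof.
move=> cM; have c0 (e : E) : 0 <= `|c e| ^+ 2 by rewrite exprn_ge0.
have [s [cs sge _]] := @has_sum_nneg R E (fun e : E => `|c e| ^+ 2) M c0 cM.
pose F := (partial_sum (fun e : E => c e *: (val e : H)) @ totally).
exists (lim F); apply: (@cauchy_cvg H F); apply: cauchy_exP => e e0.
have /has_sumP /(_ (e ^+ 2)) [|A As] := cs; first by rewrite exprn_gt0.
exists (\sum_(i <- A) c i *: (val i : H)); exists A => // B /= AB.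
rewrite partial_sumE -ball_normE /=.
(* The difference is supported on the disjoint remainder [B `\` A]. *)
rewrite (sum_fsetD (fun i : E => c i *: (val i : H)) AB).
rewrite opprD addrA subrr add0r normrN.
rewrite -(@ltr_pXn2r _ 2)// ?nnegrE ?normr_ge0 ?(ltW e0)//.
set z := \sum_(i <- _) _; have -> : `|z| ^+ 2 = '[z] by exact: inner_norm.
rewrite norm_combination//.
apply: le_lt_trans (As A (fsubset_refl A)).
rewrite ger0_norm ?subr_ge0// lerBrDl.
by rewrite -(sum_fsetD (fun i : E => `|c i| ^+ 2) AB).
Qed.

Lemma has_sum_single (I : choiceType) (j : I) (a : C) :
  has_sum (fun i => a * (i == j)%:R : C^o) a.
Proof.
apply/has_sumP => e e0; exists [fset j]%fset => B.
rewrite fsub1set => jB; rewrite (big_fsetD1 j)//= eqxx mulr1 big_seq.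
rewrite big1 ?addr0 ?subrr ?normr0// => i.
by rewrite !inE => /andP[/negPf-> _]; rewrite mulr0.
Qed.

Arguments has_sum_single {I} j a.

Lemma coef_has_sum c y : has_sum (fun e : E => c e *: (val e : H)) y ->
  forall e : E, '[y, val e] = c e.
Proof.
move=> cy e; apply: (has_sum_unique (has_sum_inner cy (val e))).
have := has_sum_single e (c e); congr has_sum; apply/funext => i.
rewrite innerZl orthonormalE//; case: eqP => [->//|_]; by rewrite !mulr0.
Qed.

(** The series converges by Bessel, and [x] minus its sum is orthogonal to the
    whole basis, hence null by maximality. *)
Lemma basis_expansion (x : H) :
  has_sum (fun e : E => '[x, val e] *: (val e : H)) x.
Proof.
have [y xy] := riesz_fischer (bessel Eon x).
suff yx : x = y by move: xy; rewrite -yx.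
apply/eqP; rewrite -subr_eq0; apply/eqP; apply: Eonb.2 => e Ee.
rewrite linearBl/=; pose e' : E := SigSub (mem_set Ee).
by rewrite (coef_has_sum xy e') subrr.
Qed.

Arguments basis_expansion x : clear implicits.

Lemma parseval (x y : H) :
  has_sum (fun e : E => '[x, val e] * '[val e, y] : C^o) '[x, y].
Proof.
have := has_sum_inner (basis_expansion x) y; congr has_sum.
by apply/funext => e; rewrite innerZl.
Qed.

End Basis.

Arguments basis_expansion {E} Eonb x.
Arguments parseval {E} Eonb x y.

Lemma has_sum_linear (I : choiceType) (A : {linear H -> H}) (f : I -> H) (s : H) :
  continuous A -> has_sum f s -> has_sum (fun i => A (f i)) (A s).
Proof.
move=> Ac fs; rewrite /has_sum.
have -> : partial_sum (fun i => A (f i)) = A \o partial_sum f.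
  by apply/funext => B /=; rewrite !partial_sumE linear_sum.
by apply: cvg_comp; [exact: fs | exact: Ac].
Qed.

(** The adjoint is [S y = sum_e <y, A e> e].  Its coefficients are
    square-summable: testing [<A x, y>] at [x = sum_(e in F) <y, A e> e] yields
    the finite sum [s] of their squares, while [|x|^2 = s], so [s <= M |x| |y|]
    gives [s <= (M |y|)^2], where [M] bounds the operator norm of [A]. *)
Lemma adjoint_exists (A : {linear H -> H}) : bounded_near A (nbhs (0 : H)) ->
  exists S : H -> H, forall x y, '[A x, y] = '[x, S y].
Proof.
move=> Abnd; have Ac : continuous A by exact/linear_bounded_continuous.
have [E Eonb] := @orthonormal_basis_exists R H.
have [M M0 AM] : exists2 M : C, 0 <= M & forall x, `|A x| <= M * `|x|.
  move/linear_boundedP : Abnd => [y [yreal fr]].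
  exists (`|y| + 1) => [|x]; first by rewrite addr_ge0.
  by apply: fr; rewrite (le_lt_trans (real_ler_norm yreal))// ltrDl.
have Abasis (x : H) :
    has_sum (fun e : E => '[x, val e] *: A (val e)) (A x).
  have := has_sum_linear Ac (basis_expansion Eonb x); congr has_sum.
  by apply/funext => e; rewrite linearZ.
have bnd (y : H) (F : {fset E}) :
    \sum_(e <- F) `|'[y, A (val e)]| ^+ 2 <= (M * `|y|) ^+ 2.
  set s := \sum_(e <- F) _.
  have s0 : 0 <= s by rewrite sumr_ge0// => e _; rewrite exprn_ge0.
  pose x := \sum_(e <- F) '[y, A (val e)] *: (val e : H).
  have xx : `|x| ^+ 2 = s by rewrite inner_norm norm_combination//; exact: Eonb.1.
  have Axy : '[A x, y] = s.
    rewrite /x linear_sum inner_suml; apply: eq_bigr => e _.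
    by rewrite linearZ /= innerZl normCK -inner_conj.
  have sM : s <= M * `|y| * `|x|.
    rewrite -(ger0_norm s0) -Axy (le_trans (cauchy_schwarz _ _))//.
    by rewrite mulrAC ler_wpM2r.
  have [x0|x0] := eqVneq x 0.
    by rewrite -xx x0 normr0 expr0n/= exprn_ge0// mulr_ge0.
  rewrite -xx ler_pXn2r// ?nnegrE ?mulr_ge0//.
  by move: sM; rewrite -xx expr2 ler_pM2r// normr_gt0.
have /choice [S SP] : forall y : H, exists s : H,
    has_sum (fun e : E => '[y, A (val e)] *: (val e : H)) s.
  by move=> y; exact: riesz_fischer Eonb _ _ (bnd y).
exists S => x y.
have h1 := has_sum_inner (Abasis x) y.
have h2 := has_sum_conj (has_sum_inner (SP y) x).
rewrite (inner_conj (S y) x).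
apply: (has_sum_unique h1); move: h2; congr has_sum; apply/funext => e.
by rewrite !innerZl rmorphM/= -!inner_conj mulrC.
Qed.

End Hilbert.

(** * Basis-independent Hilbert-Schmidt sums *)

Section HilbertSchmidt.
Context {R : realType} {H : hilbertType R}.
Local Notation C := (complex R).
Local Notation "'[ x , y ]" := (inner H x y : C).
Local Notation "'[ x ]" := (inner H x x : C).

Definition adjoint_pair (B B' : H -> H) := forall x y, '[B x, y] = '[x, B' y].

(** [z] is the squared Hilbert-Schmidt norm of [B], computed in any basis. *)
Definition hs_sum (B : H -> H) (z : C) := forall E, orthonormal_basis E ->
  has_sum (fun e : E => '[B (val e)] : C^o) z.

Lemma adjoint_pair_sym (B B' : H -> H) :
  adjoint_pair B B' -> adjoint_pair B' B.
Proof. by move=> BB' x y; rewrite inner_conj -BB' -inner_conj. Qed.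

Lemma adjoint_pairD (a b : C) (B B' D D' : H -> H) :
  adjoint_pair B B' -> adjoint_pair D D' ->
  adjoint_pair (fun x => a *: B x + b *: D x)
               (fun x => a^* *: B' x + b^* *: D' x).
Proof.
move=> BB' DD' x y.
by rewrite linearDl linearDr /= !innerZl !innerZr !conjCK BB' DD'.
Qed.

(** Parseval in [E] turns the left-hand side into a limit of finite double sums
    of [|<B e, f>|^2]; summing first over [f], Bessel in [E'] bounds each of them
    by a partial sum of [<B e, B e>].  Stopping at bounds avoids any exchange of
    two infinite sums. *)
Lemma hs_bound_adjoint (B B' : H -> H) (E E' : set H) (M : C) :
  adjoint_pair B B' -> orthonormal_basis E -> orthonormal_set E' ->
  (forall F : {fset E}, \sum_(e <- F) '[B (val e)] <= M) ->
  forall G : {fset E'}, \sum_(f <- G) '[B' (val f)] <= M.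
Proof.
move=> BB' EB E'on BM G.
pose a (f : E') (e : E) : C^o := '[B' (val f), val e] * '[val e, B' (val f)].
have aE f e : a f e = `|'[B (val e), val f]| ^+ 2.
  by rewrite /a BB' normCK -inner_conj mulrC.
have sa : has_sum (fun e => \sum_(f <- G) a f e) (\sum_(f <- G) '[B' (val f)]).
  by apply: has_sum_bigsum => f; exact: parseval EB _ _.
apply: (has_sum_le _ sa) => [e|F].
  by rewrite sumr_ge0// => f _; rewrite aE exprn_ge0.
apply: le_trans (BM F); apply: ler_sum => e _.
under eq_bigr do rewrite aE.
exact: bessel.
Qed.

(** Each of the two sums bounds the other, as being adjoint is symmetric. *)
Lemma hs_sum_adjoint (B B' : H -> H) (E E' : set H) (z : C) :
  adjoint_pair B B' -> orthonormal_basis E -> orthonormal_basis E' ->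
  has_sum (fun e : E => '[B (val e)] : C^o) z ->
  has_sum (fun f : E' => '[B' (val f)] : C^o) z.
Proof.
move=> BB' EB EB' Bz.
have n0 (D : H -> H) (K : set H) (e : K) : 0 <= '[D (val e)] by exact: inner_ge0.
have Ble := has_sum_ge (n0 B E) Bz.
have B'le := hs_bound_adjoint BB' EB EB'.1 Ble.
have [w [wsum wge wle]] := has_sum_nneg (n0 B' E') B'le.
suff <- : w = z by [].
apply/eqP; rewrite eq_le (wle _ B'le)/=.
apply: (has_sum_le (n0 B E) Bz).
exact: (hs_bound_adjoint (adjoint_pair_sym BB') EB' EB.1 wge).
Qed.

(** Going from [E] to itself through the adjoint, and from there to any other
    basis, a bound in a single basis gives a sum common to all of them. *)
Lemma hs_sum_of_bound (B B' : H -> H) (E : set H) (M : C) :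
  adjoint_pair B B' -> orthonormal_basis E ->
  (forall F : {fset E}, \sum_(e <- F) '[B (val e)] <= M) ->
  exists z, hs_sum B z.
Proof.
move=> BB' EB BM.
have n0 (e : E) : 0 <= '[B (val e)] by exact: inner_ge0.
have [z [Bz _ _]] := has_sum_nneg n0 BM.
exists z => E' EB'; have B'z := hs_sum_adjoint BB' EB EB Bz.
exact: hs_sum_adjoint (adjoint_pair_sym BB') EB EB' B'z.
Qed.

Lemma inner_combE (a b : C) (x y : H) :
  '[a *: x + b *: y] = `|a| ^+ 2 * '[x] + `|b| ^+ 2 * '[y]
    + (a * b^* * '[x, y] + (a * b^* * '[x, y])^*).
Proof.
rewrite linearDl !linearDr /= !innerZl !innerZr !normCK (inner_conj x y).
rewrite !rmorphM/= conjCK.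
by ring.
Qed.

(** Parallelogram law: the difference of the two sides is the squared norm of
    [a *: x - b *: y]. *)
Lemma inner_comb_le (a b : C) (x y : H) :
  '[a *: x + b *: y] <= 2 * (`|a| ^+ 2 * '[x] + `|b| ^+ 2 * '[y]).
Proof.
have := inner_ge0 (a *: x + (- b) *: y); rewrite !inner_combE normrN => h.
rewrite -subr_ge0; apply: le_trans h _; rewrite le_eqVlt; apply/orP; left.
by apply/eqP; rewrite rmorphN mulrN mulNr rmorphN; ring.
Qed.

(** Here [s + (p + q)] and [s + ('i * p - 'i * q)] stand for the squared norms of
    [x + y] and [x - 'i *: y], where [p] is the inner product of [x] and [y], [q]
    its conjugate and [s] the sum of their squared norms. *)
Lemma polarization_identity (p q s : C) :
  2^-1 * (s + (p + q) + - 'i * (s + ('i * p + - 'i * q)) + ('i - 1) * s) = p.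
Proof.
have ii : 'i * 'i = -1 :> C by rewrite -expr2 sqrCi.
transitivity ((2^-1 : C) * (p + q - ('i * 'i) * (p - q))); first by ring.
by rewrite ii; field.
Qed.

Section Pair.
Variables (A S : H -> H) (z : C).
Hypothesis AS : adjoint_pair A S.
Hypothesis Az : hs_sum A z.

Lemma hs_sum_adjoint_pair : hs_sum S z.
Proof. by move=> E EB; exact: (hs_sum_adjoint AS EB EB (Az EB)). Qed.

Lemma hs_sum_ge0 : 0 <= z.
Proof.
have [E EB] := @orthonormal_basis_exists R H.
have n0 (e : E) : 0 <= '[A (val e)] by exact: inner_ge0.
by have := has_sum_ge n0 (Az EB) fset0; rewrite big_seq_fset0.
Qed.

Lemma hs_sum_comb_exists (a b : C) :
  exists w, hs_sum (fun x => a *: A x + b *: S x) w.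
Proof.
have [E EB] := @orthonormal_basis_exists R H.
have n0 (D : H -> H) (e : E) : 0 <= '[D (val e)] by exact: inner_ge0.
apply: (@hs_sum_of_bound _ _ E (2 * (`|a| ^+ 2 * z + `|b| ^+ 2 * z))
  (adjoint_pairD a b AS (adjoint_pair_sym AS)) EB) => F.
apply: (le_trans (ler_sum _ (fun e _ => inner_comb_le a b _ _))).
rewrite -mulr_sumr big_split/= -!mulr_sumr ler_wpM2l// lerD// ler_wpM2l ?exprn_ge0//.
- exact: has_sum_ge (n0 A) (Az EB) F.
- exact: has_sum_ge (n0 S) (hs_sum_adjoint_pair EB) F.
Qed.

(** Besides the squared norms of [A] and of its adjoint [S], polarization
    only needs those of [A + S] and [A - 'i S], and all four have
    basis-independent sums. *)
Lemma cross_sum_exists : exists t : C, forall E, orthonormal_basis E ->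
  has_sum (fun e : E => '[A (val e), S (val e)] : C^o) t.
Proof.
have [u hu] := hs_sum_comb_exists 1 1.
have [v hv] := hs_sum_comb_exists 1 (- 'i).
exists (2^-1 * ((u - 'i * v) + ('i - 1) * (z + z))) => E EB.
have := has_sumZ (2^-1) (has_sumD
  (has_sumD (hu _ EB) (has_sumZ (- 'i) (hv _ EB)))
  (has_sumZ ('i - 1) (has_sumD (Az EB) (hs_sum_adjoint_pair EB)))).
rewrite /GRing.scale/= mulNr; congr has_sum; apply/funext => e.
have ci : (- 'i)^* = 'i :> C by rewrite rmorphN/= conjCi opprK.
rewrite !inner_combE normrN normCi normr1 !expr1n ci conjC1 !mul1r !rmorphM/=.
rewrite conjCi.
set p := '[A _, S _]; set s := '[A _]; set s' := '[S _].
by rewrite -[RHS](polarization_identity p p^* (s + s')).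
Qed.

Lemma hs_sum_comb (t : C) (a b : C) :
  (forall E, orthonormal_basis E ->
    has_sum (fun e : E => '[A (val e), S (val e)] : C^o) t) ->
  hs_sum (fun x => a *: A x + b *: S x)
   ((`|a| ^+ 2 + `|b| ^+ 2) * z + (a * b^* * t + (a * b^* * t)^*)).
Proof.
move=> At E EB; have ct := has_sumZ (a * b^*) (At E EB).
have := has_sumD (has_sumD (has_sumZ (`|a| ^+ 2) (Az EB))
  (has_sumZ (`|b| ^+ 2) (hs_sum_adjoint_pair EB))) (has_sumD ct (has_sum_conj ct)).
rewrite /GRing.scale/= -mulrDl; congr has_sum; apply/funext => e.
by rewrite inner_combE.
Qed.

End Pair.
End HilbertSchmidt.

Arguments hs_sum_comb {R H A S z} AS Az {t} a b _.

(** * Maximizing over the phase *)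

Lemma sup_max (R : realType) (X : set R) (m : R) :
  X m -> ubound X m -> sup X = m.
Proof.
move=> Xm ubm; apply/eqP; rewrite eq_le sup_le_ub//=; last by exists m.
by apply: sup_upper_bound => //; split; exists m.
Qed.

Section Cis.
Context {R : realType}.
Local Notation C := (complex R).

Lemma cis_sqr (t : R) : cis t ^+ 2 = cis (t + t).
Proof.
rewrite /cis expr2 cosD sinD; apply/eqP; rewrite eq_complex /= eqxx/=.
by apply/eqP; ring.
Qed.

Lemma conj_cisN (t : R) : (cis (- t))^* = cis t :> C.
Proof. by rewrite /cis cosN sinN /Num.conj/= opprK. Qed.

Lemma norm_cis (t : R) : `|cis t| = 1 :> C.
Proof. by rewrite normc_def /= cos2Dsin2 sqrtr1. Qed.

Lemma unit_circle_cis (x y : R) : x ^+ 2 + y ^+ 2 = 1 ->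
  exists t, cis t = (x +i* y)%C.
Proof.
move=> xy1; have x1 : -1 <= x <= 1.
  by rewrite -ler_norml -(@expr_le1 _ 2)// real_normK ?num_real// -xy1 lerDl sqr_ge0.
have sE : sin (acos x) = `|y|.
  by rewrite sin_acos// -xy1 addrC addKr sqrtr_sqr.
have [y0|y0] := leP 0 y.
  by exists (acos x); rewrite /cis sE acosK// ger0_norm.
by exists (- acos x); rewrite /cis cosN sinN sE acosK// ltr0_norm// opprK.
Qed.

(** Writing the unit number [w^* / |w|] as [cis s], the angle is [s / 2]: in the
    application the phase enters squared. *)
Lemma rotate_to_norm (w : C) : exists t : R, cis t ^+ 2 * w = `|w|.
Proof.
have [->|w0] := eqVneq w 0; first by exists 0; rewrite mulr0 normr0.
have nw0 : `|w| != 0 by rewrite normr_eq0.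
case uE : (w^* / `|w|) => [x y].
have [|s sE] := @unit_circle_cis x y.
  apply: complexI; rewrite (add_Re2_Im2 (x +i* y)%C) -uE.
  by rewrite normf_div norm_conjC normr_id divff// expr1n.
exists (s / 2); rewrite cis_sqr -splitr sE -uE mulrAC [_^* * w]mulrC -normCK.
by rewrite expr2 mulfK.
Qed.

End Cis.

(** * Traces, norms and the main identity *)

Section Norms.
Context {R : realType} {H : hilbertType R}.
Local Notation C := (complex R).

Lemma has_trace_adjoint_comp (B B' : H -> H) (z : C) : adjoint_pair B B' ->
  has_trace (adjoint B \o B) z <-> hs_sum B z.
Proof.
move=> BB'; rewrite (adjoint_unique BB').
have eqs (E : set H) : (fun e : E => inner H ((B' \o B) (val e)) (val e)) =
    (fun e : E => inner H (B (val e)) (B (val e))).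
  by apply/funext => e /=; rewrite -(adjoint_pair_sym BB').
by split=> h E EB; have := h E EB; rewrite /has_sum eqs.
Qed.

Lemma hs_norm_sqr (B B' : H -> H) (z : C) : adjoint_pair B B' -> hs_sum B z ->
  hs_norm B ^+ 2 = complex.Re z.
Proof.
move=> BB' Bz; rewrite /hs_norm (traceE ((has_trace_adjoint_comp z BB').2 Bz)).
rewrite sqr_sqrtr//; have := hs_sum_ge0 Bz.
by rewrite lecE/= => /andP[].
Qed.

End Norms.

Theorem theorem3p1 (R : realType) (H : hilbertType R) (A : {linear H -> H})
    (nu : R) (hA : hilbert_schmidt A) (hnu0 : 0 <= nu) (hnu1 : nu <= 1) :
  w2 nu A ^+ 2 =
    (2 * nu ^+ 2 - 2 * nu + 1) * hs_norm A ^+ 2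
    + 2 * nu * (1 - nu) * complex.Re `|trace (A \o A)|.
Proof.
have [Abnd [z Atr]] := hA.
have [S AS] := adjoint_exists Abnd.
have Az : hs_sum A z by exact/(has_trace_adjoint_comp z AS).
have [w hw] := cross_sum_exists AS Az.
have -> : trace (A \o A) = w.
  apply: traceE => E EB; have := hw E EB; rewrite /has_sum.
  by under [X in partial_sum X]funext => e do rewrite -AS.
rewrite (hs_norm_sqr AS Az) /w2 (adjoint_unique AS).
pose B t x := (nu%:C%C * cis t) *: A x + ((1 - nu)%:C%C * cis (- t)) *: S x.
set v := (RHS).
have hs_norm_ge0 t : 0 <= hs_norm (B t) by rewrite sqrtr_ge0.
have BE t : hs_norm (B t) ^+ 2 = (2 * nu ^+ 2 - 2 * nu + 1) * complex.Re z
    + 2 * nu * (1 - nu) * complex.Re (cis t ^+ 2 * w).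
  rewrite (hs_norm_sqr (adjoint_pairD _ _ AS (adjoint_pair_sym AS))
    (hs_sum_comb AS Az _ _ hw)).
  rewrite !normrM !norm_cis !mulr1 !normc_def /= !expr0n /= !addr0 !sqrtr_sqr.
  rewrite -!rmorphXn /= !real_normK ?num_real// -rmorphD/=.
  rewrite rmorphM/= conj_cisN.
  have -> : nu%:C%C * cis t * ((1 - nu)%:C%C^* * cis t) * w =
     (nu * (1 - nu))%:C%C * (cis t ^+ 2 * w).
    by rewrite conj_Creal ?complex_real// rmorphM/=; ring.
  (* Only real parts remain to be compared: the conjugate terms double them. *)
  clear v Az Atr; case: (cis t ^+ 2 * w) z => [p q] [z1 z2] /=.
  rewrite /Num.conj /=.
  ring.
(* The supremum is attained at the phase that makes the rotated trace nonnegative. *)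
have [s sw] := rotate_to_norm w.
have vE : hs_norm (B s) ^+ 2 = v by rewrite BE sw.
suff -> : sup [set hs_norm (B t) | t in [set: R]] = hs_norm (B s) by [].
apply: sup_max; first by exists s.
move=> _ [t _ <-]; rewrite -(@ler_pXn2r _ 2) ?nnegrE ?hs_norm_ge0// vE BE lerD2l.
apply: ler_wpM2l; first by rewrite !mulr_ge0// subr_ge0.
have tw : `|cis t ^+ 2 * w| = `|w| by rewrite normrM normrX norm_cis expr1n mul1r.
rewrite -tw; have := normc_ge_Re (cis t ^+ 2 * w).
rewrite lecE /= => /andP[_]; exact: le_trans (ler_norm _).
Qed.
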